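(* Let $T=(\Omega,(\Pi_i,t_i)_{i\in N})$ be an information structure and let $p\in\Delta(\Omega)$ be a probability distribution. Then exactly one of the following statements holds: (1) $p$ is a common prior; (2) $p$ is a multiplayer money pump.
   Context: $\Omega$ is a finite nonempty set of states, $N=\{1,\dots,n\}$ is a finite nonempty set of players, and $\Delta(\Omega)$ is the set of probability measures on $\Omega$ (all subsets measurable). An information structure is a tuple $T=(\Omega,(\Pi_i,t_i)_{i\in N})$ where, for each $i$, $\Pi_i$ is a partition of $\Omega$ and $t_i\colon\Omega\to\Delta(\Omega)$ satisfies $t_i(\omega)(\pi_i(\omega))=1$ for every $\omega$, where $\pi_i(\omega)$ is the element of $\Pi_i$ containing $\omega$, and $t_i$ is constant on each element of $\Pi_i$. A prior of player $i$ is a $p\in\Delta(\Omega)$ such that $p(E\cap\pi)=t_i(\omega)(E)\,p(\pi)$ for all $E\subseteq\Omega$, $\pi\in\Pi_i$, $\omega\in\pi$; a common prior is a $p\in\Delta(\Omega)$ that is a prior of every player. A nonempty set $S\subseteq\Omega$ is a common certainty component if for every $\omega\in S$ and $i\in N$ there is $E\subseteq S$ with $t_i(\omega)(E)=1$. An event $E\subseteq\Omega$ is commonly certain at $\omega$ if there is a common certainty component $S$ with $\omega\in S\subseteq E$. A semi-trade is a family $(f_i)_{i\in N}$ of functions $f_i\colon\Omega\to\mathbb{R}$ such that at every state $\omega\in\Omega$ the event $\{\omega'\in\Omega:\int f_i\,\mathrm{d}t_i(\omega')\ge 0\text{ for all }i\in N\}$ is commonly certain (no restriction is placed on $\sum_i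 f_i$). A distribution $p\in\Delta(\Omega)$ is a multiplayer money pump if there exists a semi-trade $(f_i)_{i\in N}$ with $\int\sum_{i\in N}f_i\,\mathrm{d}p<0$. *)

(* Defs.v *)
From mathcomp Require Import all_boot all_order all_algebra.
From mathcomp Require Import all_classical all_reals all_analysis.

Set Implicit Arguments.
Unset Strict Implicit.
Unset Printing Implicit Defensive.

Import Order.TTheory GRing.Theory Num.Theory.
Local Open Scope classical_set_scope.
Local Open Scope ring_scope.

(* A [measurableType] is pointed, hence nonempty.  Neither finiteness of the
   state space nor measurability of all events is built in here: they are
   hypotheses on [Omega] to be supplied by the user of these definitions.
   The cell of player [i] at [w] is given relationally, as the [c] such that
   [cells i c] and [c w]; it exists and is unique by [cells_partition]. *)
Record info_structure d (Omega : measurableType d) (R : realType) (n : nat) :=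
  InfoStructure {
    cells : 'I_n -> set (set Omega);
    belief : 'I_n -> Omega -> probability Omega R;
    cells_partition : forall i, partition (cells i) id [set: Omega];
    belief_cell : forall i c w, cells i c -> c w -> belief i w c = 1%E;
    belief_const : forall i c w w', cells i c -> c w -> c w' ->
      belief i w =1 belief i w'
  }.

Section InfoStructureTheory.
Context d (Omega : measurableType d) (R : realType) (n : nat).
Variable T : info_structure Omega R n.

Definition is_prior (i : 'I_n) (p : probability Omega R) : Prop :=
  forall (E c : set Omega) (w : Omega), cells T i c -> c w ->
    p (E `&` c) = (belief T i w E * p c)%E.

Definition common_prior (p : probability Omega R) : Prop :=
  forall i, is_prior i p.

Definition common_certainty_component (S : set Omega) : Prop :=
  S !=set0 /\
  forall w i, S w -> exists2 E : set Omega, E `<=` S & belief T i w E = 1%E.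

Definition commonly_certain (E : set Omega) (w : Omega) : Prop :=
  exists S, [/\ common_certainty_component S, S w & S `<=` E].

Definition semi_trade (f : 'I_n -> Omega -> R) : Prop :=
  forall w, commonly_certain
    [set w' | forall i, (0 <= \int[belief T i w']_x (f i x)%:E)%E] w.

Definition multiplayer_money_pump (p : probability Omega R) : Prop :=
  exists2 f, semi_trade f & (\int[p]_x (\sum_i f i x)%:E < 0)%E.

End InfoStructureTheory.

(* Main.v *)
(* On each cell of player [i], a prior is a nonnegative multiple of the belief
   held there, so a trade that [i] accepts everywhere has nonnegative prior
   expectation.  Conversely, if [p (E `&` c)] differs from [t(E) p(c)] for some
   event [E] and cell [c] with belief [t], then [i] is everywhere indifferent to
   the bet [\1_(E `&` c) - t(E) \1_c], whose [p]-expectation is nonzero; the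
   right multiple of this bet, and no trade for the others, is a money pump. *)
Require Import Defs.
From mathcomp Require Import all_boot all_order all_algebra.
From mathcomp Require Import finmap.
From mathcomp Require Import all_classical all_reals all_analysis.

Set Implicit Arguments.
Unset Strict Implicit.
Unset Printing Implicit Defensive.

Import Order.TTheory GRing.Theory Num.Theory.

Local Open Scope classical_set_scope.
Local Open Scope ring_scope.

(** Cells are nonempty and disjoint, so each one equals [cellof x] for any of its points [x]; hence
    [P] lies in the image of a finite set. *)
Lemma finite_partition (T : Type) (P : set (set T)) :
  finite_set [set: T] -> partition P id [set: T] -> finite_set P.
Proof.
move=> finT [_ /trivIsetP trivP neP].
pose cellof x := [set y | exists c, [/\ P c, c x & c y]].
apply: sub_finite_set (finite_image cellof finT) => c Pc.
have [x cx] := neP _ Pc; exists x => //.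
apply/seteqP; split=> y; last by move=> cy; exists c.
move=> [c' [Pc' c'x c'y]]; have [->//|/eqP c'c] := eqVneq c c'.
by have /seteqP[/(_ x)[]] := trivP c c' Pc Pc' (introN eqP c'c).
Qed.

Lemma finite_integrable d (T : measurableType d) (R : realType)
    (P : probability T R) (f : T -> R) (D : set T) :
  finite_set [set: T] -> (forall E : set T, measurable E) ->
  P.-integrable D (EFin \o f).
Proof.
move=> finT mT; apply: measurable_bounded_integrable.
- exact: mT.
- by rewrite (le_lt_trans (probability_le1 _ _)) ?ltry.
- by move=> mD Y mY; exact: mT.
have [M [Mr fM]] := compact_bounded
  (finite_compact (finite_image (f : T -> R^o) finT)).
by exists M; split => // x /fM fx y Dy; apply: fx; exists y.
Qed.

Lemma probability_setI_full d (T : measurableType d) (R : realType)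
    (P : probability T R) (A B : set T) :
  measurable A -> measurable B -> P B = 1%E -> P (A `&` B) = P A.
Proof.
move=> mA mB PB1; rewrite [RHS](measureDI P mA mB).
have PC0 : P (~` B) = 0%E by rewrite probability_setC// PB1 subee.
have PD0 : P (A `\` B) = 0%E.
  apply: subset_measure0 PC0; [exact: measurableD|exact: measurableC|].
  by move=> x [].
by rewrite [X in (X + _)%E]PD0 add0e.
Qed.

(** The belief at [w] is concentrated on the cell of [w], which is disjoint from [c]. *)
Lemma belief_other_cell d (Omega : measurableType d) (R : realType) (n : nat)
    (T : info_structure Omega R n) (i : 'I_n) (c : set Omega) (w : Omega) :
  (forall E : set Omega, measurable E) ->
  cells T i c -> ~ c w -> belief T i w c = 0%E.
Proof.
move=> mO Pc ncw; have [covP /trivIsetP trivP _] := cells_partition T i.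
have [c' Pc' c'w] : cover (cells T i) id w by rewrite covP.
have cc' : c != c' by apply/eqP => e; rewrite e in ncw.
rewrite -(probability_setI_full _ _ (belief_cell Pc' c'w))//.
by have /= -> := trivP c c' Pc Pc' cc'; rewrite measure0.
Qed.

Lemma prior_integral_ge0 d (Omega : measurableType d) (R : realType) (n : nat)
    (T : info_structure Omega R n) (i : 'I_n) (p : probability Omega R)
    (f : Omega -> R) :
  finite_set [set: Omega] -> (forall E : set Omega, measurable E) ->
  is_prior T i p ->
  (forall w, 0 <= \int[belief T i w]_x (f x)%:E)%E ->
  (0 <= \int[p]_x (f x)%:E)%E.
Proof.
move=> finO mO pri f_ge0.
have intf (P : probability Omega R) D : P.-integrable D (EFin \o f).
  exact: finite_integrable.
have mf D := measurable_int _ (intf p D).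
have [covP trivP neP] := cells_partition T i.
have finP := finite_partition finO (cells_partition T i).
have -> : [set: Omega] = \big[setU/set0]_(c <- fset_set (cells T i)) c.
  by rewrite bigsetU_fset_set// -covP.
rewrite (@integral_bigsetU_EFin _ _ _ _ _ id)//; last first.
- by rewrite fset_setK.
- exact: fset_uniq.
rewrite big_seq; apply: sume_ge0 => c.
rewrite in_fset_set// inE => Pc; have [w cw] := neP _ Pc.
have pc0 : 0 <= fine (p c) by rewrite fine_ge0.
pose k := NngNum pc0.
have kE : k%:num%:E = p c by rewrite /= fineK// fin_num_measure.
(* Inside [c], the prior condition says that [p] is the belief at [w] scaled by [p c]. *)
rewrite (@eq_measure_integral _ _ _ _ (mscale k (belief T i w))); last first.
  move=> A _ Ac; transitivity (p (A `&` c)); first by rewrite (setIidl Ac).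
  by rewrite (pri _ _ _ Pc cw) muleC -kE.
rewrite integralE !ge0_integral_mscale//.
rewrite -muleBr//; last first.
  rewrite fin_num_adde_defl// fin_numN.
  exact: (integrable_neg_fin_num _ (intf _ c)).
rewrite -integralE mule_ge0//.
(* The complement of [c] is null for the belief, so integrating over [c] gives the full expectation,
   nonnegative by hypothesis. *)
have c0 : belief T i w (~` c) = 0%E.
  by rewrite probability_setC// (belief_cell Pc cw) subee.
have := f_ge0 w; rewrite (negligible_integral _ _ (intf _ setT) c0)//.
by rewrite setTD setCK.
Qed.

Lemma integral_fine_indicB d (T : measurableType d) (R : realType)
    (P : probability T R) (A B : set T) (k a : R) :
  measurable A -> measurable B ->
  (\int[P]_x (k * (\1_A x - a * \1_B x))%:E =
   (k * (fine (P A) - a * fine (P B)))%:E)%E.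
Proof.
move=> mA mB.
have iA := integrable_indic P mA; have iB := integrable_indic P mB.
have iaB : P.-integrable setT (fun x => (a%:E * (\1_B x)%:E)%E).
  exact: integrableZl.
under eq_integral do rewrite EFinM EFinB EFinM.
rewrite integralZl//; last exact: integrableB.
rewrite integralB// integralZl// !integral_indic// !setIT.
by rewrite EFinM EFinB EFinM !fineK// fin_num_measure.
Qed.

(** A component witnessing common certainty at [w] contains [w]; conversely, the whole space is a
    component. *)
Lemma semi_tradeP d (Omega : measurableType d) (R : realType) (n : nat)
    (T : info_structure Omega R n) (f : 'I_n -> Omega -> R) :
  semi_trade T f <->
  forall w i, (0 <= \int[belief T i w]_x (f i x)%:E)%E.
Proof.
split=> [st w i|f_ge0 w]; first by have [S [_ Sw SE]] := st w; exact: SE.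
exists setT; split => //; last by move=> w' _ i; exact: f_ge0.
split; first by exists w.
by move=> w' i _; exists setT => //; exact: probability_setT.
Qed.

Lemma not_prior_money_pump d (Omega : measurableType d) (R : realType)
    (n : nat) (T : info_structure Omega R n) (i : 'I_n)
    (p : probability Omega R) :
  (forall E : set Omega, measurable E) ->
  ~ is_prior T i p -> multiplayer_money_pump T p.
Proof.
move=> mO /existsNP[E /existsNP[c /existsNP[w]]].
move=> /not_implyP[Pc /not_implyP[cw neq]].
have finE (Q : probability Omega R) A : (fine (Q A))%:E = Q A.
  by rewrite fineK// fin_num_measure.
pose a := fine (belief T i w E).
(* [D] is the [p]-expectation of the unscaled bet; the factor [- D] turns it into [- D ^+ 2],
   whatever the sign of [D]. *)
pose D := fine (p (E `&` c)) - a * fine (p c).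
pose f j x := if j == i then - D * (\1_(E `&` c) x - a * \1_c x) else 0.
exists f.
  apply/semi_tradeP => w' j; rewrite /f; case: eqP => [->|_]; last first.
    by rewrite integral0.
  rewrite integral_fine_indicB//.
  (* On [c] the belief gives [E] probability [a], so the bet is fair; off [c] both of its events are
     null. *)
  have [cw'|ncw'] := pselect (c w').
    have belc : belief T i w' c = 1%E := belief_cell Pc cw'.
    rewrite probability_setI_full// belc (belief_const Pc cw' cw) /= mulr1.
    by rewrite subrr mulr0.
  have belc : belief T i w' c = 0%E by exact: belief_other_cell.
  rewrite (@subset_measure0 _ _ _ (belief T i w') (E `&` c) c)//.
  by rewrite belc /= mulr0 subrr mulr0.
have sumf x : \sum_j f j x = - D * (\1_(E `&` c) x - a * \1_c x).
  by rewrite (bigD1 i)//= big1 ?addr0 /f ?eqxx// => j /negPf ->.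
under eq_integral do rewrite sumf.
rewrite integral_fine_indicB// lte_fin -/D mulNr oppr_lt0 -expr2.
rewrite exprn_even_gt0//=.
(* [D = 0] would be exactly the prior equation assumed to fail at [E], [c], [w]. *)
apply/eqP => D0; apply: neq.
have e := subr0_eq D0.
by rewrite -[LHS]finE e EFinM !finE.
Qed.

Theorem theorem55 (R : realType) (d : measure_display)
    (Omega : measurableType d)
    (finite_Omega : finite_set [set: Omega])
    (discrete_Omega : forall E : set Omega, measurable E)
    (n : nat) (n_gt0 : (0 < n)%N)
    (T : info_structure Omega R n) (p : probability Omega R) :
  (common_prior T p \/ multiplayer_money_pump T p) /\
  ~ (common_prior T p /\ multiplayer_money_pump T p).
Proof.
split=> [|[pri [f /semi_tradeP f_ge0]]].
  have [pri|/existsNP[i npri]] := pselect (common_prior T p); first by left.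
  by right; exact: not_prior_money_pump npri.
(* The expected sum is the sum of the players' expectations, each nonnegative under a common
   prior. *)
apply/negP; rewrite -leNgt.
under eq_integral do rewrite -sumEFin.
rewrite integral_sum//; last by move=> i; exact: finite_integrable.
by apply: sume_ge0 => i _; exact: prior_integral_ge0 (pri i) _.
Qed.
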